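(* The following statements hold. (i) Let $A$ be a real symmetric positive definite $n\times n$ matrix, $a\in\mathbb{R}^n$, $V\in C^\infty(\mathbb{T}^n)$. Suppose that $\psi\in C^\infty(\mathbb{T}^n)$ and $c\in\mathbb{R}$ satisfy $$\det(A+D^2\psi)=e^{-t\,a\cdot D\psi+tV-c},\qquad A+D^2\psi>0\quad\text{on }\mathbb{T}^n,$$ for some $t\in[0,1]$. Then $$t\min_{\mathbb{T}^n}V-\log\det A\le c\le t\max_{\mathbb{T}^n}V-\log\det A.$$ (ii) Fix a real symmetric positive definite $A$ and $a\in\mathbb{R}^n$, let $V_1,V_2\in C^\infty(\mathbb{T}^n)$, and suppose that for $i=1,2$ the pair $(\psi_i,c_i)$ solves the cell problem with data $(A,a,V_i)$. Then $$\min_{\mathbb{T}^n}(V_1-V_2)\le c_1-c_2\le\max_{\mathbb{T}^n}(V_1-V_2).$$ In particular, $|c_1-c_2|\le\|V_1-V_2\|_{L^\infty(\mathbb{T}^n)}$. (iii) Fix $a\in\mathbb{R}^n$ and $V\in C^\infty(\mathbb{T}^n)$. Suppose that $A_1,A_2$ are real symmetric positive definite matrices with $A_1\le A_2$ in the sense of quadratic forms. If $c_{A_i}$ denotes the normalizing constant corresponding to $A_i$ (with the given $a,V$), then $c_{A_1}\ge c_{A_2}$. If $A_2-A_1>0$, then the inequality is strict.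
   Context: $\mathbb{T}^n=\mathbb{R}^n/\mathbb{Z}^n$. A pair $(\psi,c)\in C^\infty(\mathbb{T}^n)\times\mathbb{R}$ solves the cell problem with data $(A,a,V)$ if $$\det(A+D^2\psi)=\exp\{-a\cdot D\psi+V-c\},\qquad A+D^2\psi>0\quad\text{on }\mathbb{T}^n.$$ For every symmetric $A>0$, $a\in\mathbb{R}^n$, $V\in C^\infty(\mathbb{T}^n)$ there is a solution $(\psi_A,c_A)$ of this problem with $\int_{\mathbb{T}^n}\psi_A=0$, and it is unique; $c_A$ is called the normalizing constant. For symmetric matrices, $M>0$ means positive definite. *)

(* Defs.v *)
From HB Require Import structures.
From mathcomp Require Import all_boot all_order all_algebra.
From mathcomp Require Import all_classical all_reals all_analysis.

Set Implicit Arguments.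
Unset Strict Implicit.
Unset Printing Implicit Defensive.

Import Order.TTheory GRing.Theory Num.Theory.
Import numFieldNormedType.Exports.

Local Open Scope classical_set_scope.
Local Open Scope ring_scope.

(* Points of R^n are row vectors.  A function on T^n = R^n/Z^n is a
   Z^n-periodic function on R^n. *)

Section TorusFunctions.
Context {R : realType} {n : nat}.
Implicit Types (f : 'rV[R]_n -> R) (x : 'rV[R]_n).

Definition partial (i : 'I_n) f x : R := 'D_(delta_mx ord0 i) f x.

Definition grad f x : 'rV[R]_n := \row_i partial i f x.

Definition hessian f x : 'M[R]_n := \matrix_(i, j) partial i (partial j f) x.

Definition dot (a b : 'rV[R]_n) : R := \sum_i a ord0 i * b ord0 i.

(* Partial derivatives of every order exist everywhere and are continuous. *)
Definition smooth f : Prop :=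
  forall s : seq 'I_n,
    continuous (foldr partial f s) /\
    forall i x, derivable (foldr partial f s) x (delta_mx ord0 i).

Definition periodic f : Prop :=
  forall (k : 'rV[int]_n) x, f (x + map_mx intr k) = f x.

Definition Cinfty_torus f : Prop := periodic f /\ smooth f.

(* For f continuous on T^n these infimum and supremum are attained, see
   torus_min_attained and torus_max_attained below. *)
Definition torus_min f : R := inf (range f).
Definition torus_max f : R := sup (range f).

Definition qform (M : 'M[R]_n) (v : 'rV[R]_n) : R :=
  (v *m M *m v^T) ord0 ord0.

(* Symmetry is a separate clause (sym_posdef): the Hessian of a smooth function
   is symmetric by Schwarz's theorem, so it is not assumed of A + hessian psi. *)
Definition posdef (M : 'M[R]_n) : Prop :=
  forall v : 'rV[R]_n, v != 0 -> 0 < qform M v.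

Definition sym_posdef (M : 'M[R]_n) : Prop := M^T = M /\ posdef M.

Definition qform_le (M N : 'M[R]_n) : Prop :=
  forall v : 'rV[R]_n, qform M v <= qform N v.

Definition solves_cell (A : 'M[R]_n) (a : 'rV[R]_n) (V : 'rV[R]_n -> R)
    (psi : 'rV[R]_n -> R) (c : R) : Prop :=
  [/\ Cinfty_torus psi,
      forall x, \det (A + hessian psi x) =
                expR (- dot a (grad psi x) + V x - c)
    & forall x, posdef (A + hessian psi x)].

End TorusFunctions.

Section TorusAttained.
Context {R : realType} {n : nat}.
Implicit Types (f : 'rV[R]_n -> R) (x : 'rV[R]_n).

Let cube : set 'rV[R]_n := [set v | forall i, `[0, 1]%classic (v ord0 i)].

Let cube_compact : compact cube.
Proof.
apply: (@rV_compact R n (fun=> `[0, 1]%classic)) => i.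
exact: segment_compact.
Qed.

Let cube_repr f : periodic f -> forall x, exists2 y, cube y & f y = f x.
Proof.
move=> pf x.
exists (x + map_mx intr (\row_i (- Num.floor (x ord0 i)))); last exact: pf.
move=> i; rewrite !mxE /= in_itv /= rmorphN /= subr_ge0 floor_le /=.
by rewrite lerBlDl -[X in _ + X]/(1%:~R) -intrD1 ltW // floorD1_gt.
Qed.

Lemma torus_max_attained f : periodic f -> continuous f ->
  exists2 x, torus_max f = f x & forall y, f y <= f x.
Proof.
move=> pf cf.
have cube0 : cube !=set0.
  by have [y cy _] := cube_repr pf 0; exists y.
have [|x _ fx] := compact_EVT_max cube0 cube_compact (f := f).
  exact: continuous_subspaceT.
have maxx y : f y <= f x.
  by have [z cz <-] := cube_repr pf y; apply: fx; rewrite inE.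
exists x => //; apply/eqP; rewrite eq_le; apply/andP; split.
  by apply: ge_sup; [exists (f x); exists x | move=> _ [y _ <-]].
by apply: ub_le_sup; [exists (f x) => _ [y _ <-] | exists x].
Qed.

Lemma torus_min_attained f : periodic f -> continuous f ->
  exists2 x, torus_min f = f x & forall y, f x <= f y.
Proof.
move=> pf cf.
have pg : periodic (fun x => - f x) by move=> k x; rewrite pf.
have cg : continuous (fun x => - f x) by move=> x; apply: continuousN; exact: cf.
have [x _ fx] := torus_max_attained pg cg.
have minx y : f x <= f y by rewrite -lerN2.
exists x => //; apply/eqP; rewrite eq_le; apply/andP; split.
  by apply: ge_inf; [exists (f x) => _ [y _ <-] | exists x].
by apply: lb_le_inf; [exists (f x); exists x | move=> _ [y _ <-]].
Qed.

End TorusAttained.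

(* The Lebesgue measure of T^n, carried by the fundamental domain [0, 1]^n: the
   n-fold product of the uniform probability on [0, 1], on n-tuples of reals. *)
Section TorusMeasure.
Context (R : realType).
Local Notation mR := (measurableTypeR R).

Definition cons_tuple n (p : mR * n.-tuple mR) : n.+1.-tuple mR :=
  [tuple of p.1 :: p.2].

Lemma measurable_cons_tuple n :
  measurable_fun [set: mR * n.-tuple mR] (@cons_tuple n).
Proof. exact: measurable_cons. Qed.

HB.instance Definition _ n :=
  isMeasurableFun.Build _ _ _ _ (@cons_tuple n) (@measurable_cons_tuple n).

Fixpoint torus_measure n : probability (n.-tuple mR) R :=
  if n is m.+1 return probability (n.-tuple mR) R then
    distribution (uniform_prob (@ltr01 R) \x torus_measure m)%E (@cons_tuple m)
  else dirac ([tuple] : 0.-tuple mR).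

Definition row_of_tuple n (t : n.-tuple mR) : 'rV[R]_n := \row_i tnth t i.

Definition torus_integral n (f : 'rV[R]_n -> R) : \bar R :=
  (\int[torus_measure n]_t (f (row_of_tuple t))%:E)%E.

Definition torus_Linfty n (f : 'rV[R]_n -> R) : \bar R :=
  Lnorm (torus_measure n) +oo%E (fun t => (f (row_of_tuple t))%:E).

End TorusMeasure.

(* "c is the constant c_A": a relation rather than a function of (A, a, V),
   since existence and uniqueness of the normalized solution is a theorem. *)
Definition normalizing_constant (R : realType) (n : nat) (A : 'M[R]_n)
    (a : 'rV[R]_n) (V : 'rV[R]_n -> R) (c : R) : Prop :=
  exists psi : 'rV[R]_n -> R,
    solves_cell A a V psi c /\ torus_integral psi = 0%E.

(* Main.v *)
Require Import Defs.
From HB Require Import structures.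
From mathcomp Require Import all_boot all_order all_algebra.
From mathcomp Require Import all_classical all_reals all_analysis.
From mathcomp Require Import ess_sup_inf ring lra.

(* At a maximum point x of f - g on the torus the gradients of f and g agree
   and D^2 f <= D^2 g, so A1 <= A2 gives 0 < A1 + D^2 f <= A2 + D^2 g at x.  The
   determinant is monotone on symmetric positive definite matrices, hence the
   right-hand sides of the two equations are ordered at x, and the drift terms
   cancel.  Part (i) is the comparison of psi with 0, (ii) and (iii) compare two
   solutions.  Monotonicity of det goes by induction on the size through the
   Schur complement, whose quadratic form is the minimum of that of the matrix
   over the first variable and is therefore monotone too.  The bound by the
   L^infty norm needs that boxes have positive measure. *)

Import Order.TTheory GRing.Theory Num.Theory.
Import numFieldNormedType.Exports.

Set Implicit Arguments.
Unset Strict Implicit.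
Unset Printing Implicit Defensive.

Local Open Scope classical_set_scope.
Local Open Scope ring_scope.

(** * Determinants of positive definite matrices *)

Definition schur_compl (R : realType) (n : nat) (M : 'M[R]_(1 + n)) : 'M[R]_n :=
  drsubmx M - (M ord0 ord0)^-1 *: (dlsubmx M *m ursubmx M).

Lemma ulsubmx_scalar (R : realType) (n : nat) (M : 'M[R]_(1 + n)) :
  ulsubmx M = (M ord0 ord0)%:M.
Proof.
by rewrite [ulsubmx M]mx11_scalar !mxE; congr (M _ _)%:M; apply: val_inj.
Qed.

(** One step of block elimination: the unipotent [L] clears the column below the pivot, and the
    product is upper block triangular. *)
Lemma det_schur (R : realType) (n : nat) (M : 'M[R]_(1 + n)) :
  M ord0 ord0 != 0 -> \det M = M ord0 ord0 * \det (schur_compl M).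
Proof.
move=> M0; set a := M ord0 ord0.
pose L : 'M[R]_(1 + n) := block_mx 1%:M 0 (- a^-1 *: dlsubmx M) 1%:M.
have -> : \det M = \det (L *m M) by rewrite det_mulmx det_lblock !det1 !mul1r.
rewrite -{1}(submxK M) /L mulmx_block !mul1mx !mul0mx !addr0 ulsubmx_scalar.
rewrite -!scalemxAl -/a mul_mx_scalar scalerA mulNr mulVf// scaleN1r addNr.
by rewrite det_ublock det_scalar1 addrC scaleNr.
Qed.

(* Completing the square in the first variable. *)
Lemma qform_schur (R : realType) (n : nat) (M : 'M[R]_(1 + n)) (u : R) v :
    M^T = M -> M ord0 ord0 != 0 ->
  qform M (row_mx u%:M v) =
    M ord0 ord0 * (u + (v *m dlsubmx M) ord0 ord0 / M ord0 ord0) ^+ 2 +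
    qform (schur_compl M) v.
Proof.
move=> MT M0; rewrite /qform /schur_compl; set a := M ord0 ord0.
have uT : ursubmx M = (dlsubmx M)^T by rewrite trmx_dlsub MT.
rewrite -{1}(submxK M) mul_row_block tr_row_mx mul_row_col.
rewrite ulsubmx_scalar -/a tr_scalar_mx.
set c := dlsubmx M; set D := drsubmx M.
rewrite mulmxBr mulmxBl -scalemxAr -scalemxAl uT.
rewrite mul_mx_scalar !mulmxDl !mul_scalar_mx -scalemxAl.
(* By symmetry the off-diagonal blocks are transposes of each other, so the Schur correction is the
   square of the scalar [v *m c]. *)
have -> : v *m (c *m c^T) *m v^T = (v *m c) *m (v *m c)^T.
  by rewrite trmx_mul !mulmxA.
have -> : c^T *m v^T = (v *m c)^T by rewrite trmx_mul.
rewrite !mxE big_ord_recl big_ord0 addr0 !mxE.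
set s := \sum_j _; set q := \sum_j _.
rewrite eqxx mulr1n; field.
exact: M0.
Qed.

Lemma qform_row1 (R : realType) (n : nat) (M : 'M[R]_(1 + n)) :
  qform M (row_mx 1%:M 0) = M ord0 ord0.
Proof.
rewrite /qform -{1}(submxK M) mul_row_block tr_row_mx mul_row_col.
by rewrite !mul0mx !addr0 !mul1mx tr_scalar_mx mulmx1 trmx0 mulmx0 addr0
  ulsubmx_scalar mxE eqxx mulr1n.
Qed.

Lemma row_mx1_neq0 (R : realType) (n : nat) :
  row_mx 1%:M 0 != 0 :> 'rV[R]_(1 + n).
Proof.
apply/eqP => /(congr1 lsubmx); rewrite row_mxKl linear0 => /matrixP/(_ ord0 ord0).
by rewrite !mxE eqxx => /eqP; rewrite oner_eq0.
Qed.

Lemma posdef_corner (R : realType) (n : nat) (M : 'M[R]_(1 + n)) :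
  posdef M -> 0 < M ord0 ord0.
Proof. by move=> /(_ _ (@row_mx1_neq0 R n)); rewrite qform_row1. Qed.

(** This first coordinate makes the square in [qform_schur] vanish; for a positive pivot it is the
    minimizer. *)
Lemma schur_min (R : realType) (n : nat) (M : 'M[R]_(1 + n)) v :
    M^T = M -> M ord0 ord0 != 0 ->
  qform (schur_compl M) v =
    qform M (row_mx (- ((v *m dlsubmx M) ord0 ord0 / M ord0 ord0))%:M v).
Proof. by move=> MT M0; rewrite qform_schur// addNr expr0n mulr0 add0r. Qed.

Lemma sym_posdef_schur (R : realType) (n : nat) (M : 'M[R]_(1 + n)) :
  sym_posdef M -> sym_posdef (schur_compl M).
Proof.
move=> [MT Mp]; have M0 := lt0r_neq0 (posdef_corner Mp); split.
  rewrite /schur_compl linearB/= linearZ/= trmx_mul.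
  by rewrite trmx_drsub trmx_ursub trmx_dlsub MT.
move=> v v0; rewrite schur_min//; apply: Mp; apply: contra_neq v0.
by move=> /(congr1 rsubmx); rewrite row_mxKr linear0.
Qed.

(** Take the first coordinate that is optimal for [N]. There the form of [M] is at most that of [N],
    and dropping the completed square of [M] only decreases it further. *)
Lemma schur_le (R : realType) (n : nat) (M N : 'M[R]_(1 + n)) :
    sym_posdef M -> sym_posdef N -> qform_le M N ->
  qform_le (schur_compl M) (schur_compl N).
Proof.
move=> [MT Mp] [NT Np] MN v; have M0 := posdef_corner Mp.
rewrite [leRHS]schur_min ?gt_eqF ?(posdef_corner Np)//.
apply: le_trans (MN _); rewrite qform_schur ?gt_eqF// lerDr.
by rewrite mulr_ge0 ?sqr_ge0// ltW.
Qed.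

Lemma det_posdef_gt0 (R : realType) (n : nat) (M : 'M[R]_n) :
  sym_posdef M -> 0 < \det M.
Proof.
elim: n M => [|n IHn] M Ms; first by rewrite det_mx00.
have M0 := posdef_corner Ms.2.
by rewrite (@det_schur _ _ M) ?gt_eqF// mulr_gt0// IHn//; exact: sym_posdef_schur.
Qed.

(** In the Schur factorization both factors are monotone: the pivot is the form at the first basis
    vector, and the complements are compared by induction. *)
Lemma det_posdef_le (R : realType) (n : nat) (M N : 'M[R]_n) :
  sym_posdef M -> sym_posdef N -> qform_le M N -> \det M <= \det N.
Proof.
elim: n M N => [|n IHn] M N Ms Ns MN; first by rewrite !det_mx00.
have M0 := posdef_corner Ms.2; have N0 := posdef_corner Ns.2.
rewrite (@det_schur _ _ M) ?(@det_schur _ _ N) ?gt_eqF//.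
apply: ler_pM => //; [exact: ltW | | |].
- exact/ltW/det_posdef_gt0/sym_posdef_schur.
- by rewrite -!qform_row1; exact: MN.
- by apply: IHn; [exact: sym_posdef_schur..|exact: schur_le].
Qed.

Lemma qformD (R : realType) (n : nat) (M N : 'M[R]_n) v :
  qform (M + N) v = qform M v + qform N v.
Proof. by rewrite /qform mulmxDr mulmxDl mxE. Qed.

Lemma qformN (R : realType) (n : nat) (M : 'M[R]_n) v :
  qform (- M) v = - qform M v.
Proof. by rewrite /qform mulmxN mulNmx mxE. Qed.

(** Strictness comes from the pivots alone; the complements are compared weakly. In size 0 both
    determinants are 1, hence [0 < n]. *)
Lemma det_posdef_lt (R : realType) (n : nat) (M N : 'M[R]_n) : (0 < n)%N ->
  sym_posdef M -> sym_posdef N -> posdef (N - M) -> \det M < \det N.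
Proof.
case: n M N => // n M N _ Ms Ns MNp.
have MN : qform_le M N.
  move=> v; have [->|v0] := eqVneq v 0; first by rewrite /qform !mul0mx.
  by have := MNp v v0; rewrite qformD qformN subr_gt0 => /ltW.
have M0 := posdef_corner Ms.2; have N0 := posdef_corner Ns.2.
rewrite (@det_schur _ _ M) ?(@det_schur _ _ N) ?gt_eqF//.
apply: (@le_lt_trans _ _ (M ord0 ord0 * \det (schur_compl N))).
  rewrite ler_pM2l//; apply: det_posdef_le; [exact: sym_posdef_schur..|].
  exact: schur_le.
rewrite ltr_pM2r; last exact/det_posdef_gt0/sym_posdef_schur.
by have := posdef_corner MNp; rewrite !mxE subr_gt0.
Qed.

(** * Second order conditions at a maximum *)

(** The difference quotient of the restriction to the line is that of [f] in direction [v] at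
    [x + s *: v]. *)
Lemma is_derive_line (R : realType) (n : nat) (f : 'rV[R]_n -> R) x v (s : R) :
    derivable f (x + s *: v) v ->
  is_derive s (1 : R) (fun r : R => f (x + r *: v)) ('D_v f (x + s *: v)).
Proof.
move=> df.
have E : (fun h : R => h^-1 *:
     (((fun r : R => f (x + r *: v)) \o shift s) (h *: (1 : R)) - f (x + s *: v))) =
   (fun h => h^-1 *: ((f \o shift (x + s *: v)) (h *: v) - f (x + s *: v))).
  apply/funext => h /=; congr (_ *: (f _ - _)).
  by rewrite [h *: 1]mulr1 scalerDl addrCA.
by apply: DeriveDef; rewrite /derivable /derive E.
Qed.

(** The bound on [c] by absolute values lets [h] have either sign, or vanish, in the limits
    below. *)
Lemma MVT_line (R : realType) (n : nat) (f : 'rV[R]_n -> R) x v (h : R) :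
    (forall y, derivable f y v) ->
  exists2 c, `|c| <= `|h| & f (x + h *: v) - f x = h * 'D_v f (x + c *: v).
Proof.
move=> df; pose g (r : R) := f (x + r *: v).
have dg s : is_derive s (1 : R) g ('D_v f (x + s *: v)) by exact: is_derive_line.
have cg (a b : R) : {within `[a, b], continuous g}.
  by apply: derivable_within_continuous => s _; have [] := dg s.
have g0 : g 0 = f x by rewrite /g scale0r addr0.
have [h0|h0|->] := ltgtP h 0.
- have [c ch] := MVT h0 (fun s _ => dg s) (cg _ _).
  move: ch; rewrite in_itv/= => /andP[hc c0] E; exists c.
    by rewrite !ltr0_norm// lerN2 ltW.
  by rewrite -/(g h) -g0 -[LHS]opprB E sub0r mulrN opprK mulrC.
- have [c ch] := MVT h0 (fun s _ => dg s) (cg _ _).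
  move: ch; rewrite in_itv/= => /andP[hc c0] E; exists c.
    by rewrite !gtr0_norm// ltW.
  by rewrite -/(g h) -g0 E subr0 mulrC.
- by exists 0 => //; rewrite scale0r addr0 subrr mul0r.
Qed.

(** The asymmetry suits an induction on directions: ['D_u f] is continuous everywhere, while along
    [v] a derivative at [x] alone is assumed. *)
Lemma is_deriveDdir (R : realType) (n : nat) (f : 'rV[R]_n -> R)
    (x u v : 'rV[R]_n) (dv : R) :
    (forall y, derivable f y u) -> continuous ('D_u f) -> is_derive x v f dv ->
  is_derive x (u + v) f ('D_u f x + dv).
Proof.
move=> du cu [df <-].
suff L : (fun h => h^-1 *: ((f \o shift x) (h *: (u + v)) - f x)) @ 0^' -->
    'D_u f x + 'D_v f x.
  by apply: DeriveDef; [exact: cvgP L | exact: cvg_lim L].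
(* The increment is split into a move along [v] (the quotient [G]) followed by a move along [u] from
   the displaced point (the quotient [F]). *)
pose F h := h^-1 *: (f (x + h *: v + h *: u) - f (x + h *: v)).
pose G h := h^-1 *: ((f \o shift x) (h *: v) - f x).
have -> : (fun h => h^-1 *: ((f \o shift x) (h *: (u + v)) - f x)) =
    (fun h => F h + G h).
  apply/funext => h; rewrite /F /G /= -[RHS]scalerDr [h *: (u + v)]scalerDr.
  apply: congr1.
  have -> : h *: u + h *: v + x = x + h *: v + h *: u.
    by rewrite addrC addrA addrAC.
  by rewrite [h *: v + x]addrC addrA subrK.
apply: cvgD; last exact: df.
apply/cvgrPdist_lt => e e0.
have /cvgrPdist_lt/(_ e e0)/nbhs_normP[d /= d0 Hd] := cu x.
near=> h.
have h0 : h != 0 by near: h; exact: nbhs_dnbhs_neq.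
(* The summand 1 keeps the later denominator positive when [u] and [v] both vanish. *)
have uv0 : 0 < `|u| + `|v| + 1 by rewrite ltr_pwDr// addr_ge0.
have [c ch] := @MVT_line _ _ f (x + h *: v) u h du.
rewrite /F => ->; rewrite [_ *: _]mulrA mulVf// mul1r.
apply: Hd; rewrite /= -addrA opprD addNKr normrN.
have hd : `|h| < d / (`|u| + `|v| + 1).
  near: h; apply: dnbhs0_lt; exact: divr_gt0.
rewrite (le_lt_trans (ler_normD _ _))// !normrZ.
apply: (@le_lt_trans _ _ (`|h| * (`|u| + `|v| + 1))).
  rewrite !mulrDr mulr1.
  have := ler_wpM2r (normr_ge0 u) ch; have := normr_ge0 h; lra.
by rewrite -ltr_pdivlMr.
Unshelve. all: by end_near. Qed.

(** Chain rule for the restriction to the line composed with the dilation [m]; this treats [k = 0]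
    uniformly. *)
Lemma is_deriveZdir (R : realType) (n : nat) (f : 'rV[R]_n -> R) x v (k dv : R) :
  is_derive x v f dv -> is_derive x (k *: v) f (k * dv).
Proof.
move=> [df <-].
have df0 : derivable f (x + 0 *: v) v by rewrite scale0r addr0.
have := is_derive_line df0; rewrite scale0r addr0 => dg.
pose m (h : R) := h * k.
have dm : is_derive (0 : R) (1 : R) m k.
  have H := is_deriveM (is_derive_id (0 : R) (1 : R)) (is_derive_cst k (0 : R) 1).
  by apply: is_derive_eq; rewrite scaler0 add0r [_ *: _]mulr1.
rewrite -[X in is_derive X](mul0r k) -/(m 0) in dg.
have [] := is_derive1_comp dg dm; rewrite /derivable /derive.
have -> : (fun h : R => h^-1 *: ((((fun r : R => f (x + r *: v)) \o m) \o shift 0)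
     (h *: (1 : R)) - ((fun r : R => f (x + r *: v)) \o m) 0)) =
   (fun h => h^-1 *: ((f \o shift x) (h *: (k *: v)) - f x)).
  apply/funext => h; rewrite /= /m mul0r scale0r addr0 addr0 scalerA.
  by rewrite [h *: 1]mulr1 [x + _]addrC.
by move=> cf Ef; apply: DeriveDef => //; rewrite mulrC.
Qed.

Definition C1_fun (R : realType) (n : nat) (f : 'rV[R]_n -> R) : Prop :=
  forall i, continuous (partial i f) /\ forall x, derivable f x (delta_mx ord0 i).

(** The coordinate components of [v] are added one at a time: the new one has a continuous
    derivative, and the induction hypothesis differentiates along the sum of the others. *)
Lemma C1_fun_is_derive (R : realType) (n : nat) (f : 'rV[R]_n -> R) x v :
  C1_fun f -> is_derive x v f (\sum_i v ord0 i * partial i f x).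
Proof.
move=> f1.
rewrite {1}(row_sum_delta v : v = \sum_i v ord0 i *: delta_mx ord0 i).
elim: (index_enum _) => [|i r IHr].
  rewrite !big_nil.
  have E : (fun h : R => h^-1 *: ((f \o shift x) (h *: 0) - f x)) = cst 0.
    by apply/funext => h; rewrite /= scaler0 add0r subrr scaler0.
  apply: DeriveDef; rewrite /derivable /derive E; first exact: is_cvg_cst.
  exact: lim_cst.
have du y : is_derive y (v ord0 i *: delta_mx ord0 i) f (v ord0 i * partial i f y).
  by apply: is_deriveZdir; apply: DeriveDef => //; have [] := f1 i.
have Du : 'D_(v ord0 i *: delta_mx ord0 i) f = fun y => v ord0 i * partial i f y.
  by apply/funext => y; have [] := du y.
rewrite !big_cons; have -> : v ord0 i * partial i f x =
  'D_(v ord0 i *: delta_mx ord0 i) f x by have [_ <-] := du x.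
apply: is_deriveDdir => //.
by rewrite Du => y; exact: cvgMl_tmp ((f1 i).1 y).
Qed.

(** * Symmetry of second derivatives *)

(** Two mean value steps: along [u] for the increment [g], then along [v] for ['D_u f]. *)
Lemma second_difference (R : realType) (n : nat) (f : 'rV[R]_n -> R)
    (x u v : 'rV[R]_n) (h : R) :
    (forall y, derivable f y u) -> (forall y, derivable ('D_u f) y v) ->
  exists s t : R, [/\ `|s| <= `|h|, `|t| <= `|h| &
    f (x + h *: u + h *: v) - f (x + h *: u) - f (x + h *: v) + f x =
    h * h * 'D_v ('D_u f) (x + s *: u + t *: v)].
Proof.
move=> du dvu.
pose g y := f (y + h *: v) - f y.
have dg y : is_derive y u g ('D_u f (y + h *: v) - 'D_u f y).
  apply: is_deriveB; last exact: DeriveDef.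
  have E : (fun k : R => k^-1 *:
      (((fun y => f (y + h *: v)) \o shift y) (k *: u) - f (y + h *: v)))
     = (fun k : R => k^-1 *: ((f \o shift (y + h *: v)) (k *: u) - f (y + h *: v))).
    by apply/funext => k /=; rewrite addrA.
  by apply: DeriveDef; rewrite /derivable /derive E //; exact: du.
have [s sh Es] := @MVT_line _ _ g x u h (fun y => @ex_derive _ _ _ _ _ _ _ (dg y)).
have [t th Et] := @MVT_line _ _ _ (x + s *: u) v h dvu.
exists s, t; split => //.
rewrite -mulrA -Et; have [_ <-] := dg (x + s *: u); rewrite -Es /g.
by rewrite opprB addrA addrAC.
Qed.

(* Both sides are approximated by the same second difference over h ^+ 2. *)
Lemma deriveC (R : realType) (n : nat) (f : 'rV[R]_n -> R) (x u v : 'rV[R]_n) :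
    (forall y, derivable f y u) -> (forall y, derivable f y v) ->
    (forall y, derivable ('D_u f) y v) -> (forall y, derivable ('D_v f) y u) ->
    continuous ('D_v ('D_u f)) -> continuous ('D_u ('D_v f)) ->
  'D_v ('D_u f) x = 'D_u ('D_v f) x.
Proof.
move=> du dv dvu duv cvu cuv; apply/eqP; rewrite -subr_eq0 -normr_le0.
apply/ler_addgt0Pr => e e0; rewrite add0r.
have e2 : 0 < e / 2 by rewrite divr_gt0.
have key (p q r : R) : `|p - r| < e / 2 -> `|q - r| < e / 2 -> `|p - q| <= e.
  by move=> pr qr; have := ler_distD r p q; rewrite (distrC r q); lra.
have /cvgrPdist_lt/(_ _ e2)/nbhs_normP[a /= a0 Ha] := cvu x.
have /cvgrPdist_lt/(_ _ e2)/nbhs_normP[b /= b0 Hb] := cuv x.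
have uv0 : 0 < `|u| + `|v| + 1 by rewrite ltr_pwDr// addr_ge0.
pose d := Num.min a b; have d0 : 0 < d by rewrite lt_min a0.
(* With this step all intermediate points lie within [d] of [x], so one fixed [h] suffices for a
   given [e]. *)
pose h := d / 2 / (`|u| + `|v| + 1).
have h0 : 0 < h by rewrite !divr_gt0.
have hd : h * (`|u| + `|v|) < d.
  apply: (@lt_le_trans _ _ (h * (`|u| + `|v| + 1))).
    by rewrite ltr_pM2l// ltrDl.
  by rewrite /h divfK ?gt_eqF//; lra.
have small (s t : R) (y w : 'rV[R]_n) : `|s| <= `|h| -> `|t| <= `|h| ->
    `|x - (x + s *: y + t *: w)| <= h * (`|y| + `|w|).
  rewrite (gtr0_norm h0) => sh th; rewrite -addrA opprD addNKr normrN.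
  rewrite (le_trans (ler_normD _ _))// !normrZ mulrDr.
  by apply: lerD; apply: ler_wpM2r.
have [s [t [sh th E1]]] := @second_difference _ _ f x u v h du dvu.
have [s' [t' [sh' th' E2]]] := @second_difference _ _ f x v u h dv duv.
(* The second difference is invariant under exchanging [u] and [v], so the two mixed derivatives
   share a value at points near [x]. *)
have E : 'D_v ('D_u f) (x + s *: u + t *: v) = 'D_u ('D_v f) (x + s' *: v + t' *: u).
  apply: (mulfI (_ : h * h != 0)); first by rewrite mulf_neq0 ?gt_eqF.
  apply: etrans (esym E1) _; apply: etrans E2.
  rewrite [x + h *: v + h *: u]addrAC; apply: (congr1 (+%R ^~ (f x))).
  exact: addrAC.
have da : d <= a by rewrite ge_min lexx.
have db : d <= b by rewrite ge_min lexx orbT.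
have B1 := Ha _ (lt_le_trans (le_lt_trans (small _ _ u v sh th) hd) da).
rewrite addrC in hd.
have B2 := Hb _ (lt_le_trans (le_lt_trans (small _ _ v u sh' th') hd) db).
by rewrite E in B1; exact: key B1 B2.
Qed.

(** * Derivative tests at a maximum *)

(** If [g'' c] were positive, it would stay positive to the right of [c], and two mean value steps
    from [g' c = 0] would give [g (c + e / 2) > g c]. *)
Lemma second_derivative_max (R : realType) (g g' g'' : R -> R) (c : R) :
    (forall s, is_derive s (1 : R) g (g' s)) ->
    (forall s, is_derive s (1 : R) g' (g'' s)) ->
    {for c, continuous g''} -> (forall s, g s <= g c) ->
  g' c = 0 /\ g'' c <= 0.
Proof.
move=> dg dg' cg'' gmax.
have g'c : g' c = 0.
  have ci : c \in `]c - 1, c + 1[ by rewrite in_itv/=; lra.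
  have [|] := @derive1_at_max R g (c - 1) (c + 1) c _
    (fun t _ => @ex_derive _ _ _ _ _ _ _ (dg t)) ci (fun t _ => gmax t).
    by lra.
  by move=> _ <-; have [] := dg c.
split=> //; rewrite leNgt; apply/negP => g''c.
have /cvgrPdist_lt/(_ _ g''c)/nbhs_normP[e /= e0 He] := cg''.
have pos s : c < s < c + e -> 0 < g'' s.
  move=> /andP[cs se]; have sc : `|c - s| < e by rewrite ltr_norml; lra.
  by have := He s sc; rewrite /= ltr_norml; lra.
have cont (k k' : R -> R) (dk : forall s, is_derive s (1 : R) k (k' s)) (a b : R) :
    {within `[a, b], continuous k}.
  by apply: derivable_within_continuous => s _; have [] := dk s.
have ce : c < c + e / 2 by lra.
have [s] := MVT ce (fun s _ => dg s) (cont _ _ dg _ _).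
rewrite in_itv/= => /andP[cs se] Es.
have [t] := MVT cs (fun s _ => dg' s) (cont _ _ dg' _ _).
rewrite in_itv/= g'c subr0 => /andP[ct ts] Et.
have := gmax (c + e / 2); rewrite -subr_le0 Es Et leNgt => /negP; apply.
by rewrite !mulr_gt0 ?subr_gt0// pos//; lra.
Qed.

(** [foldr] applies the last index first, so the new index goes to the end of the list. *)
Lemma smooth_partial (R : realType) (n : nat) (f : 'rV[R]_n -> R) i :
  smooth f -> smooth (partial i f).
Proof. by move=> fs s; have := fs (rcons s i); rewrite foldr_rcons. Qed.

Lemma smooth_C1_fun (R : realType) (n : nat) (f : 'rV[R]_n -> R) : smooth f -> C1_fun f.
Proof. by move=> fs i; split; [have [] := fs [:: i] | have [_] := fs [::]]. Qed.

Lemma smoothB_foldr (R : realType) (n : nat) (f g : 'rV[R]_n -> R) (s : seq 'I_n) :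
  smooth f -> smooth g ->
  foldr partial (fun x => f x - g x) s =
    fun x => foldr partial f s x - foldr partial g s x.
Proof.
move=> fs gs; elim: s => //= i s ->; apply/funext => x.
have [_ df] := fs s; have [_ dg] := gs s.
by rewrite {1}/partial deriveB.
Qed.

Lemma smoothB (R : realType) (n : nat) (f g : 'rV[R]_n -> R) :
  smooth f -> smooth g -> smooth (fun x => f x - g x).
Proof.
move=> fs gs s; rewrite smoothB_foldr//.
have [cf df] := fs s; have [cg dg] := gs s; split.
  by move=> x; exact: continuousB (cf x) (cg x).
by move=> i x; apply: derivableB.
Qed.

Lemma gradB (R : realType) (n : nat) (f g : 'rV[R]_n -> R) x :
  smooth f -> smooth g -> grad (fun x => f x - g x) x = grad f x - grad g x.
Proof.
move=> fs gs; apply/rowP => i; rewrite !mxE.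
by have /(congr1 (@^~ x)) /= := smoothB_foldr [:: i] fs gs.
Qed.

Lemma hessianB (R : realType) (n : nat) (f g : 'rV[R]_n -> R) x :
  smooth f -> smooth g -> hessian (fun x => f x - g x) x = hessian f x - hessian g x.
Proof.
move=> fs gs; apply/matrixP => i j; rewrite !mxE.
by have /(congr1 (@^~ x)) /= := smoothB_foldr [:: i; j] fs gs.
Qed.

(** Supplies the symmetry clause of [sym_posdef] for [A + hessian psi x], which [posdef] does not
    contain. *)
Lemma hessian_sym (R : realType) (n : nat) (f : 'rV[R]_n -> R) x :
  smooth f -> (hessian f x)^T = hessian f x.
Proof.
move=> fs; apply/matrixP => i j; rewrite !mxE.
have [_ df] := fs [::].
apply: deriveC => //.
- by move=> y; have [_] := fs [:: i]; apply.
- by move=> y; have [_] := fs [:: j]; apply.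
- by have [] := fs [:: j; i].
- by have [] := fs [:: i; j].
Qed.

Lemma smooth_derive_line (R : realType) (n : nat) (f : 'rV[R]_n -> R) x v (s : R) :
  smooth f -> is_derive s (1 : R) (fun r : R => f (x + r *: v))
    (\sum_i v ord0 i * partial i f (x + s *: v)).
Proof.
move=> fs; have [df <-] := C1_fun_is_derive (x + s *: v) v (smooth_C1_fun fs).
exact: is_derive_line.
Qed.

Lemma qform_sum (R : realType) (n : nat) (M : 'M[R]_n) v :
  qform M v = \sum_i v ord0 i * \sum_j v ord0 j * M j i.
Proof.
by rewrite /qform mxE; apply: eq_bigr => i _; rewrite !mxE mulrC.
Qed.

Lemma continuous_lincomb (R : realType) (T : topologicalType) (n : nat) (c : 'I_n -> R)
    (f : 'I_n -> T -> R) (x : T) :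
  (forall i, {for x, continuous (f i)}) ->
  {for x, continuous (fun y => \sum_i c i * f i y)}.
Proof.
move=> cf; elim: (index_enum _) => [|i r IHr].
  have -> : (fun y => \sum_(i <- [::]) c i * f i y) = cst 0.
    by apply/funext => y; rewrite big_nil.
  exact: cst_continuous.
have -> : (fun y => \sum_(j <- i :: r) c j * f j y) =
    (fun y => c i * f i y + \sum_(j <- r) c j * f j y).
  by apply/funext => y; rewrite big_cons.
by apply: continuousD; [exact: cvgMl_tmp (cf i) | exact: IHr].
Qed.

(** Restrict [f] to each line through [x] and apply the one-variable test at parameter 0; basis
    vectors then give the gradient. *)
Lemma smooth_max (R : realType) (n : nat) (f : 'rV[R]_n -> R) x :
  smooth f -> (forall y, f y <= f x) ->
  grad f x = 0 /\ forall v, qform (hessian f x) v <= 0.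
Proof.
move=> fs fmax.
have H (v : 'rV[R]_n) : \sum_i v ord0 i * partial i f x = 0 /\
    qform (hessian f x) v <= 0.
  pose g (r : R) := f (x + r *: v).
  pose g' (r : R) := \sum_i v ord0 i * partial i f (x + r *: v).
  pose g'' (r : R) := qform (hessian f (x + r *: v)) v.
  have dg s : is_derive s (1 : R) g (g' s) by exact: smooth_derive_line.
  have Eg'' : g'' = fun r =>
      \sum_i v ord0 i * \sum_j v ord0 j * partial j (partial i f) (x + r *: v).
    apply/funext => r; rewrite /g'' qform_sum; apply: eq_bigr => i _.
    by congr (_ * _); apply: eq_bigr => j _; rewrite mxE.
  have dg' s : is_derive s (1 : R) g' (g'' s).
    have Eg' : g' = \sum_i (fun r : R => v ord0 i * partial i f (x + r *: v)).
      by apply/funext => r; rewrite fct_sumE.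
    rewrite Eg' Eg''; apply: is_derive_sum => i.
    apply: is_deriveZ; apply: smooth_derive_line; exact: smooth_partial.
  have cg'' : {for 0, continuous g''}.
    rewrite Eg''; apply: continuous_lincomb => i; apply: continuous_lincomb => j.
    apply: (@continuous_comp _ _ _ (fun r : R => x + r *: v) (partial j (partial i f))).
      by apply: cvgD; [exact: cvg_cst | apply: cvgZr_tmp; exact: cvg_id].
    exact: (fs [:: j; i]).1.
  have := second_derivative_max dg dg' cg''.
  by rewrite /g /g' /g'' scale0r addr0; apply.
split=> [|v]; last by have [] := H v.
apply/rowP => i; rewrite !mxE.
have [+ _] := H (delta_mx ord0 i).
rewrite (bigD1 i)//= mxE !eqxx mul1r big1 ?addr0// => j ji.
by rewrite mxE eqxx (negbTE ji) mul0r.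
Qed.

Lemma touching_point (R : realType) (n : nat) (f g : 'rV[R]_n -> R) :
    Cinfty_torus f -> Cinfty_torus g ->
  exists x, grad f x = grad g x /\ qform_le (hessian f x) (hessian g x).
Proof.
move=> [fp fs] [gp gs]; have ws := smoothB fs gs.
have wp : Defs.periodic (fun x => f x - g x) by move=> k x; rewrite fp gp.
have [cw _] := ws [::]; have [x _ xmax] := torus_max_attained wp cw.
have [g0 H] := smooth_max ws xmax.
exists x; split; first by apply/eqP; rewrite -subr_eq0 -gradB// g0.
by move=> v; rewrite -subr_le0 -qformN -qformD -(hessianB x fs gs); exact: H.
Qed.

(** * Positivity of the torus measure on boxes *)

(** The centre may be an endpoint of the unit interval, so the ball is first cut down to []lo, hi[],
    where the density is 1. *)
Lemma uniform_prob_ball_gt0 (R : realType) (p e : R) : 0 <= p <= 1 -> 0 < e ->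
  (0 < uniform_prob (@ltr01 R) `](p - e)%R, (p + e)%R[)%E.
Proof.
move=> /andP[p0 p1] e0.
pose lo := Num.max 0 (p - e); pose hi := Num.min 1 (p + e).
have lohi : lo < hi.
  by rewrite gt_max !lt_min; apply/andP; split; apply/andP; split; lra.
apply: (@lt_le_trans _ _ (uniform_prob (@ltr01 R) `]lo, hi[)); last first.
  apply: le_measure; rewrite ?inE//; apply: subset_itv; rewrite bnd_simp.
    by rewrite le_max lexx orbT.
  by rewrite ge_min lexx orbT.
rewrite /uniform_prob (eq_integral (fun=> 1%:E)); last first.
  move=> z; rewrite inE/= in_itv/= gt_max lt_min => /andP[/andP[z0 _] /andP[z1 _]].
  by rewrite /uniform_pdf !ltW// subr0 invr1.
rewrite integral_cst//= lebesgue_measure_itv/= lte_fin lohi mul1e -EFinB lte_fin.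
by rewrite subr_gt0.
Qed.

(** The open sup-norm ball of the row vectors, transported to tuples, where [torus_measure]
    lives. *)
Definition tuple_box (R : realType) (n : nat) (p : 'I_n -> R) (e : R) :
    set (n.-tuple (measurableTypeR R)) :=
  [set t | forall i, `]p i - e, p i + e[%classic (tnth t i)].

Lemma measurable_tuple_box (R : realType) (n : nat) (p : 'I_n -> R) (e : R) :
  measurable (tuple_box p e).
Proof.
have -> : tuple_box p e = \bigcap_(i in [set: 'I_n])
    ((fun t => tnth t i) @^-1` `]p i - e, p i + e[).
  by apply/seteqP; split=> t H i; [move=> _; exact: H | exact: (H i)].
apply: fin_bigcap_measurable => // i _.
rewrite -[X in measurable X]setTI; apply: measurable_tnth => //.
Qed.

(** Pulled back along [cons_tuple], a box is an interval times a lower-dimensional box; in dimension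
    0 the measure is a Dirac mass. *)
Lemma torus_measure_box_gt0 (R : realType) (n : nat) (p : 'I_n -> R) (e : R) :
  (forall i, 0 <= p i <= 1) -> 0 < e -> (0 < torus_measure R n (tuple_box p e))%E.
Proof.
move=> + e0; elim: n p => [|n IHn] p p01 /=.
  by rewrite diracE mem_set ?lte_fin// => -[].
rewrite /distribution /pushforward /=.
have -> : @Defs.cons_tuple R n @^-1` tuple_box p e =
    `]p ord0 - e, p ord0 + e[ `*` tuple_box (p \o lift ord0) e.
  apply/seteqP; split=> -[r t] /=.
    move=> H; split; first exact: (H ord0).
    by move=> i; have := H (lift ord0 i); rewrite tnthS.
  move=> [/= r0 H] i; case: (unliftP ord0 i) => [j|] ->; last exact: r0.
  by rewrite tnthS; exact: H.
rewrite product_measure1E//; last exact: measurable_tuple_box.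
apply: mule_gt0; first exact: uniform_prob_ball_gt0.
by apply: IHn => i; exact: p01.
Qed.

(** If the essential supremum were below the value at a point, continuity would give a box around it
    inside the exceptional null set. *)
Lemma torus_Linfty_ge (R : realType) (n : nat) (f : 'rV[R]_n -> R) (x : 'rV[R]_n) :
  Defs.periodic f -> continuous f -> (`|f x|%:E <= torus_Linfty f)%E.
Proof.
move=> fp cf.
(* The representative of [x] in the unit cube, where the measure is carried. *)
pose y : 'rV[R]_n := x + map_mx intr (\row_i (- Num.floor (x ord0 i))).
have y01 i : 0 <= y ord0 i <= 1.
  rewrite !mxE rmorphN /= subr_ge0 floor_le /=.
  by rewrite lerBlDl -[X in _ + X]/(1%:~R) -intrD1 ltW // floorD1_gt.
rewrite -(fp (\row_i (- Num.floor (x ord0 i))) x) -/y.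
have mu1 : (0 < torus_measure R n [set: _])%E by rewrite probability_setT lte01.
rewrite /torus_Linfty unlock /Lnorm mu1 leNgt; apply/negP => Lf.
set L := ess_sup _ _ in Lf.
have L0 : (0 <= L)%E.
  by apply: ess_sup_gee => //; apply: nearW => t /=.
have Lr : L = (fine L)%:E by rewrite fineK// ge0_fin_numE// (lt_trans Lf)// ltry.
rewrite Lr lte_fin in Lf.
(* [A] is a null set containing all tuples where the absolute value of [f] exceeds [L]. *)
have := ess_sup_ge (torus_measure R n) (abse \o (fun t => (f (row_of_tuple t))%:E)).
rewrite -/L Lr => -[A [mA A0 sA]].
have cnf : {for y, continuous (fun z => `|f z|)}.
  exact: continuous_comp (cf y) (@norm_continuous _ _ _).
have /nbhs_ballP[e /= e0 He] : \forall z \near y, fine L < `|f z|.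
  exact: cvgr_gt cnf _ Lf.
have : (torus_measure R n (tuple_box (y ord0) e) <= torus_measure R n A)%E.
  apply: le_measure; rewrite ?inE//; first exact: measurable_tuple_box.
  move=> t Bt; apply: sA => /=; rewrite lee_fin leNgt => /negP; apply.
  apply: He; split=> // i j; rewrite (ord1 i) /ball /=.
  have -> : row_of_tuple t 0 j = tnth t j by rewrite mxE.
  by have := Bt j; rewrite /= in_itv/= distrC ltr_distl.
have {}A0 : torus_measure R n A = 0%E by exact: A0.
by rewrite A0 leNgt torus_measure_box_gt0.
Qed.

(** * The comparison principle *)

Lemma foldr_partial0 (R : realType) (n : nat) (s : seq 'I_n) :
  foldr partial (fun=> 0 : R) s = fun=> 0.
Proof. by elim: s => //= i s ->; apply/funext => x; exact: derive_cst. Qed.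

Lemma Cinfty_torus0 (R : realType) (n : nat) :
  Cinfty_torus (fun _ : 'rV[R]_n => 0).
Proof.
split=> // s; rewrite foldr_partial0; split; first by move=> x; exact: cst_continuous.
by move=> i x; exact: derivable_cst.
Qed.

Lemma grad0 (R : realType) (n : nat) (x : 'rV[R]_n) : grad (fun=> 0) x = 0.
Proof. by apply/rowP => i; rewrite !mxE; exact: derive_cst. Qed.

Lemma hessian0 (R : realType) (n : nat) (x : 'rV[R]_n) : hessian (fun=> 0) x = 0.
Proof.
apply/matrixP => i j; rewrite !mxE.
by have /(congr1 (@^~ x)) := @foldr_partial0 R n [:: i; j].
Qed.

Lemma dotr0 (R : realType) (n : nat) (a : 'rV[R]_n) : dot a 0 = 0.
Proof. by rewrite /dot big1// => i _; rewrite mxE mulr0. Qed.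

Lemma qform_leD (R : realType) (n : nat) (A1 A2 H1 H2 : 'M[R]_n) :
  qform_le A1 A2 -> qform_le H1 H2 -> qform_le (A1 + H1) (A2 + H2).
Proof.
move=> A12 H12 v; rewrite [leLHS]qformD [leRHS]qformD.
by apply: lerD; [exact: A12 | exact: H12].
Qed.

Lemma posdef_subD (R : realType) (n : nat) (A1 A2 H1 H2 : 'M[R]_n) :
  posdef (A2 - A1) -> qform_le H1 H2 -> posdef (A2 + H2 - (A1 + H1)).
Proof.
move=> A12 H12 v v0; rewrite opprD addrACA qformD.
apply: ltr_pwDl; first exact: A12.
by rewrite qformD qformN subr_ge0; exact: H12.
Qed.

(** Abstract right-hand sides let the same statement serve for solutions and for the zero function;
    equal gradients are returned so that the drift can be cancelled. *)
Lemma det_comparison (R : realType) (n : nat) (A1 A2 : 'M[R]_n)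
    (f g F G : 'rV[R]_n -> R) :
    (0 < n)%N -> A1^T = A1 -> A2^T = A2 -> qform_le A1 A2 ->
    Cinfty_torus f -> Cinfty_torus g ->
    (forall x, posdef (A1 + hessian f x)) -> (forall x, posdef (A2 + hessian g x)) ->
    (forall x, \det (A1 + hessian f x) = F x) ->
    (forall x, \det (A2 + hessian g x) = G x) ->
  exists x, [/\ grad f x = grad g x, F x <= G x & posdef (A2 - A1) -> F x < G x].
Proof.
move=> n0 A1T A2T A12 fC gC fpos gpos detF detG.
have [x [Dfg Hfg]] := touching_point fC gC.
have s1 : sym_posdef (A1 + hessian f x).
  by split=> //; rewrite linearD /= A1T hessian_sym//; case: fC.
have s2 : sym_posdef (A2 + hessian g x).
  by split=> //; rewrite linearD /= A2T hessian_sym//; case: gC.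
exists x; rewrite -(detF x) -(detG x); split; first exact: Dfg.
  by apply: det_posdef_le s1 s2 _; exact: qform_leD.
by move=> A12p; apply: det_posdef_lt n0 s1 s2 _; exact: posdef_subD.
Qed.

Theorem lemma3p3 (R : realType) (n : nat) (n_gt0 : (0 < n)%N) :
  [/\
    (* (i) *)
    forall (A : 'M[R]_n) (a : 'rV[R]_n) (V psi : 'rV[R]_n -> R) (c t : R),
      sym_posdef A -> Cinfty_torus V -> Cinfty_torus psi ->
      0 <= t <= 1 ->
      (forall x : 'rV[R]_n,
         \det (A + hessian psi x) =
         expR (- t * dot a (grad psi x) + t * V x - c)) ->
      (forall x : 'rV[R]_n, posdef (A + hessian psi x)) ->
      t * torus_min V - ln (\det A) <= c <= t * torus_max V - ln (\det A),
    (* (ii) *)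
    forall (A : 'M[R]_n) (a : 'rV[R]_n) (V1 V2 psi1 psi2 : 'rV[R]_n -> R)
        (c1 c2 : R),
      sym_posdef A -> Cinfty_torus V1 -> Cinfty_torus V2 ->
      solves_cell A a V1 psi1 c1 -> solves_cell A a V2 psi2 c2 ->
      torus_min (fun x => V1 x - V2 x) <= c1 - c2
        <= torus_max (fun x => V1 x - V2 x) /\
      (`|c1 - c2|%:E <= torus_Linfty (fun x => V1 x - V2 x)%R)%E
    & (* (iii) *)
    forall (a : 'rV[R]_n) (V : 'rV[R]_n -> R) (A1 A2 : 'M[R]_n) (c1 c2 : R),
      Cinfty_torus V -> sym_posdef A1 -> sym_posdef A2 -> qform_le A1 A2 ->
      normalizing_constant A1 a V c1 -> normalizing_constant A2 a V c2 ->
      c2 <= c1 /\ (posdef (A2 - A1) -> c2 < c1)].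
Proof.
have refl (A : 'M[R]_n) : qform_le A A by [].
split.
- move=> A a V psi c t As [Vp Vs] psiC /andP[t0 _] eqn pos.
  have [AT Ap] := As; have dA := det_posdef_gt0 As.
  have pos0 x : posdef (A + hessian (fun=> 0) x) by rewrite hessian0 addr0.
  (* The zero function solves an equation of the same exponential form, so only exponents have to be
     compared. *)
  have eq0 x : \det (A + hessian (fun=> 0) x) = expR (ln (\det A)).
    by rewrite hessian0 addr0 lnK.
  have C0 := @Cinfty_torus0 R n.
  have [cV _] := Vs [::].
  have [m -> Vm] := torus_min_attained Vp cV.
  have [M -> VM] := torus_max_attained Vp cV.
  apply/andP; split.
    have [x [Dx le _]] :=
      det_comparison n_gt0 AT AT (refl A) psiC C0 pos pos0 eqn eq0.
    move: le; rewrite Dx grad0 dotr0 mulr0 add0r ler_expR.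
    by have := ler_wpM2l t0 (Vm x); lra.
  (* Exchanging the two functions moves the contact point to a minimum of [psi]. *)
  have [x [Dx le _]] :=
    det_comparison n_gt0 AT AT (refl A) C0 psiC pos0 pos eq0 eqn.
  move: le; rewrite -Dx grad0 dotr0 mulr0 add0r ler_expR.
  by have := ler_wpM2l t0 (VM x); lra.
- move=> A a V1 V2 psi1 psi2 c1 c2 [AT _] [V1p V1s] [V2p V2s].
  move=> [C1 E1 P1] [C2 E2 P2].
  have Wp : Defs.periodic (fun x => V1 x - V2 x) by move=> k x; rewrite V1p V2p.
  have [Wc _] := smoothB V1s V2s [::].
  have [m Em Vm] := torus_min_attained Wp Wc.
  have [M EM VM] := torus_max_attained Wp Wc.
  (* At a maximum of [psi1 - psi2] the exponents give [V1 x - c1 <= V2 x - c2]; the upper bound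
     exchanges the indices. *)
  have lo : V1 m - V2 m <= c1 - c2.
    have [x [-> le _]] := det_comparison n_gt0 AT AT (refl A) C1 C2 P1 P2 E1 E2.
    by move: le (Vm x); rewrite ler_expR; lra.
  have hi : c1 - c2 <= V1 M - V2 M.
    have [x [-> le _]] := det_comparison n_gt0 AT AT (refl A) C2 C1 P2 P1 E2 E1.
    by move: le (VM x); rewrite ler_expR; lra.
  split; first by rewrite Em EM lo hi.
  (* A nonnegative difference is controlled by the value at the maximum point [M], a negative one by
     the value at the minimum point [m]. *)
  case: (ger0P (c1 - c2)) => _.
    apply: le_trans (torus_Linfty_ge M Wp Wc).
    by rewrite lee_fin; exact: le_trans hi (ler_norm _).
  apply: le_trans (torus_Linfty_ge m Wp Wc).
  by rewrite lee_fin -normrN; apply: le_trans (ler_norm _); rewrite lerN2.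
- move=> a V A1 A2 c1 c2 _ [A1T _] [A2T _] A12.
  move=> [psi1 [[C1 E1 P1] _]] [psi2 [[C2 E2 P2] _]].
  have [x [Dx le lt]] := det_comparison n_gt0 A1T A2T A12 C1 C2 P1 P2 E1 E2.
  (* Drift and potential agree on both sides at [x], which leaves only [c1] and [c2] to compare. *)
  move: le lt; rewrite Dx ler_expR ltr_expR => le lt.
  by split=> [|/lt]; lra.
Qed.
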